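(* Let $G$ be a locally compact second countable sofic group, $\Sigma=(M_i)_{i\ge1}$ a sofic approximation to $G$, $G\curvearrowright(X,\mu)$ a jointly continuous probability-measure-preserving action on a compact metrizable space $X$, and $\rho:X\times X\to[0,1]$ a continuous generating pseudometric. Let $\widetilde\Sigma=(M_i,\mathrm{vol}_{M_i},\widetilde L_i)_{i\ge1}$ be the completion of $\Sigma$ given by $\widetilde L_i(g,p)=g.p$ if $(g,p)$ lies in the domain of the partial action on $M_i$ and $\widetilde L_i(g,p)=p$ otherwise. Then $$h^{\mathrm{meas}}_\Sigma(G,X,\mu,\rho)=h^{\mathrm{Singh,pseudo}}_{\widetilde\Sigma}(\mu,\rho).$$ Moreover the common value is independent of how the partial action is completed outside its domain: the same equality holds if the $\widetilde L_i$ are replaced by arbitrary Borel maps $G\times M_i\to M_i$ agreeing with the partial action on its domain. The completion $\widetilde\Sigma$ depends only on $\Sigma$, not on the action or the compact model.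
   Context: **Local $G$-spaces and sofic approximations.** Let $e$ be the identity of $G$ and $m_G$ a fixed right Haar measure. A local left $G$-space is a locally compact second countable Hausdorff space $M$ with a continuous map $\vartheta:\mathrm{dom}(\vartheta)\to M$, written $\vartheta(g,p)=g.p$, with $\mathrm{dom}(\vartheta)\subseteq G\times M$ open, such that for every $p\in M$: (1) $(e,p)\in\mathrm{dom}(\vartheta)$ and $e.p=p$; (2) if $(g,p)\in\mathrm{dom}(\vartheta)$ then $(g^{-1},g.p)\in\mathrm{dom}(\vartheta)$ and $g^{-1}.(g.p)=p$; (3) if $(h,p),(g,h.p),(gh,p)\in\mathrm{dom}(\vartheta)$ then $(gh).p=g.(h.p)$; (4) there is an open neighborhood $V_p$ of $e$ with $V_p\times\{p\}\subseteq\mathrm{dom}(\vartheta)$ such that $g\mapsto g.p$ is a homeomorphism from $V_p$ onto an open neighborhood of $p$. A chart centered at $p$ is a homeomorphism $f_p$ from an open neighborhood $\mathrm{dom}(f_p)$ of $p$ onto an open neighborhood $\mathrm{rng}(f_p)$ of $e$ with $f_p(g.p)=g$ for all $g\in\mathrm{rng}(f_p)$. The canonical measure $\mathrm{vol}_M$ is the unique Radon measure on $M$ with $\mathrm{vol}_M(E)=m_G(f_p(E))$ for every chart $f_p$ and every Borel $E\subseteq\mathrm{dom}(f_p)$. For precompact open $U\subseteq G$, $M[U]$ is the set of $p\in M$ such that (i) if $g,h,gh\in U$ then $g.(h.p)=(gh).p$ with both sides defined, and (ii) $g\mapsto g.p$ is a homeomorphism from $U$ onto an open neighborhood of $p$.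 $M$ is a $(U,\varepsilon)$-sofic approximation if $0<\mathrm{vol}_M(M)<\infty$ and $\mathrm{vol}_M(M[U])\ge(1-\varepsilon)\mathrm{vol}_M(M)$. A sofic approximation to $G$ is a sequence $\Sigma=(M_i)_{i\ge1}$ with $M_i$ a $(U_i,\varepsilon_i)$-sofic approximation, where the $U_i$ are precompact open, $U_1\subseteq U_2\subseteq\cdots$, $\bigcup_iU_i=G$, and $\varepsilon_i\to0$. $G$ is sofic if it admits a sofic approximation. **Generating pseudometric.** A continuous pseudometric $\rho$ on $X$ is generating if for all distinct $x,y\in X$ there is $g\in G$ with $\rho(gx,gy)>0$. **Notation.** Put $\overline{\mathrm{vol}}_i=\mathrm{vol}_{M_i}/\mathrm{vol}_{M_i}(M_i)$ and $M_i[g]=\{p\in M_i:(g,p)\text{ is in the domain of the partial action}\}$. For measurable $\phi,\psi:M_i\to X$ let $\rho_{1,i}(\phi,\psi)=\int\rho(\phi(p),\psi(p))\,d\overline{\mathrm{vol}}_i(p)$ and $\rho_{2,i}(\phi,\psi)=\bigl(\int\rho(\phi(p),\psi(p))^2\,d\overline{\mathrm{vol}}_i(p)\bigr)^{1/2}$. $\mathrm{Sep}_\varepsilon(E,d)$ is the maximal cardinality of a subset of $E$ whose distinct elements are at $d$-distance $>\varepsilon$ ($\mathrm{Sep}_\varepsilon(\varnothing)=0$, $\log0=-\infty$, $\log\infty=\infty$). For finite $\mathcal F\subset C(X)$ and $\eta>0$, $\mathcal O(\mathcal F,\eta)=\{\nu\in\mathrm{Prob}(X):|\int f\,d\nu-\int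 f\,d\mu|<\eta\ \forall f\in\mathcal F\}$. **Local spatial entropy.** For $g\in G$ set $E^B_i(\phi,g)=\overline{\mathrm{vol}}_i(M_i\setminus M_i[g])+\int_{M_i[g]}\rho(\phi(g.p),g\phi(p))\,d\overline{\mathrm{vol}}_i(p)$. For a precompact open neighborhood $U$ of $e$, $\delta>0$ and a weak-star neighborhood $\mathcal O$ of $\mu$, $\mathrm{Map}(M_i,X,\rho:U,\delta,\mathcal O)$ is the set of measurable $\phi:M_i\to X$ with $E^B_i(\phi,g)<\delta$ for all $g\in U$ and $\phi_*\overline{\mathrm{vol}}_i\in\mathcal O$. Then $$h^{\mathrm{meas}}_\Sigma(G,X,\mu,\rho)=\lim_{\varepsilon\downarrow0}\ \inf_{\mathcal O}\inf_U\inf_{\delta>0}\limsup_{i\to\infty}\frac1{\mathrm{vol}_{M_i}(M_i)}\log\mathrm{Sep}_\varepsilon\bigl(\mathrm{Map}(M_i,X,\rho:U,\delta,\mathcal O),\rho_{1,i}\bigr).$$ **Singh's pseudometric entropy.** For $g\in G$ set $E^S_i(\phi,g)=\bigl(\int_{M_i}\rho(\phi(\widetilde L_i(g,p)),g\phi(p))^2\,d\overline{\mathrm{vol}}_i(p)\bigr)^{1/2}$. Let $\mathrm{Map}_S(i;U,\delta,\mathcal F)$ be the set of measurable $\phi:M_i\to X$ with $E^S_i(\phi,g)<\delta$ for all $g\in U$ and $\phi_*\overline{\mathrm{vol}}_i\in\mathcal O(\mathcal F,\delta)$. Then $$h^{\mathrm{Singh,pseudo}}_{\widetilde\Sigma}(\mu,\rho)=\sup_{0<\varepsilon<1}\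 \inf_{\mathcal F}\inf_U\inf_{\delta>0}\limsup_{i\to\infty}\frac1{\mathrm{vol}_{M_i}(M_i)}\log\mathrm{Sep}_\varepsilon\bigl(\mathrm{Map}_S(i;U,\delta,\mathcal F),\rho_{2,i}\bigr),$$ with $\mathcal F$ ranging over finite subsets of $C(X)$ and $U$ over precompact open neighborhoods of $e$. *)

(* Defs.v *)
From HB Require Import structures.
From mathcomp Require Import all_boot all_order all_algebra.
From mathcomp Require Import all_classical all_reals all_analysis.

Set Implicit Arguments.
Unset Strict Implicit.
Unset Printing Implicit Defensive.

Import Order.TTheory GRing.Theory Num.Theory.
Import numFieldTopology.Exports numFieldNormedType.Exports.

Local Open Scope classical_set_scope.
Local Open Scope ring_scope.

(* Measurable types are pointed in MathComp-Analysis, hence the use of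
   [ptopologicalType] for every space that carries a measure. This only
   excludes the empty space, which supports no nonzero measure. *)

HB.mixin Record isTopGroup G & PointedTopological G & Group G := {
  mulg_continuous : continuous (fun x : G * G => (x.1 * x.2)%g) ;
  invg_continuous : continuous (fun x : G => (x^-1)%g)
}.

#[short(type="topGroupType")]
HB.structure Definition TopGroup :=
  {G of PointedTopological G & Group G & isTopGroup G}.

Notation borel T := (g_sigma_algebraType (@open T)).

(* [f] restricts to a homeomorphism from [A] onto [B]; its values outside [A]
   are irrelevant. *)
Definition homeo_onto (S T : topologicalType) (A : set S) (B : set T)
    (f : S -> T) : Prop :=
  exists f' : T -> S,
    [/\ {within A, continuous f}, {within B, continuous f'},
        (forall x, A x -> B (f x) /\ f' (f x) = x) &
        (forall y, B y -> A (f' y) /\ f (f' y) = y)].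

Record is_pseudometric (R : realType) (T : Type) (d : T -> T -> R) : Prop := {
  pseudometric_ge0 : forall x y, 0 <= d x y ;
  pseudometric_xx : forall x, d x x = 0 ;
  pseudometric_sym : forall x y, d x y = d y x ;
  pseudometric_triangle : forall x y z, d x z <= d x y + d y z
}.

Definition metrizable (R : realType) (T : topologicalType) : Prop :=
  exists d : T -> T -> R,
    [/\ is_pseudometric d, (forall x y, d x y = 0 -> x = y) &
        (forall x, nbhs x = nbhs_ball_ (fun y e => [set z | d y z < e]) x)].

Definition precompact_open_nbhs1 (G : topGroupType) : set (set G) :=
  [set U | [/\ open U, precompact U & U 1%g]].
Arguments precompact_open_nbhs1 : clear implicits.

Section measures.
Local Open Scope ereal_scope.

Record radon_measure (R : realType) (T : ptopologicalType)
    (m : {measure set (borel T) -> \bar R}) : Prop := {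
  radon_compact : forall K : set T, compact K -> m K < +oo ;
  radon_outer : forall E : set (borel T), measurable E ->
    m E = ereal_inf [set m O | O in [set O : set T | open O /\ E `<=` O]] ;
  radon_inner : forall O : set T, open O ->
    m O = ereal_sup [set m K | K in [set K : set T | compact K /\ K `<=` O]]
}.

Record right_haar_measure (R : realType) (G : topGroupType)
    (m : {measure set (borel G) -> \bar R}) : Prop := {
  haar_radon : radon_measure m ;
  haar_neq0 : 0 < m [set: G] ;
  haar_right_invariant : forall (g : G) (E : set (borel G)), measurable E ->
    m [set (x * g)%g | x in E] = m E
}.

End measures.

(* The partial action is encoded by its domain [lgs_dom] and a total function
   [lgs_act], whose values outside the domain are never used. *)
Record localGSpace (G : topGroupType) := LocalGSpace {
  lgs_carrier :> ptopologicalType ;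
  lgs_locally_compact : locally_compact [set: lgs_carrier] ;
  lgs_second_countable : @second_countable lgs_carrier ;
  lgs_hausdorff : hausdorff_space lgs_carrier ;
  lgs_dom : set (G * lgs_carrier) ;
  lgs_act : G -> lgs_carrier -> lgs_carrier ;
  lgs_dom_open : open lgs_dom ;
  lgs_continuous :
    {within lgs_dom, continuous (fun gp => lgs_act gp.1 gp.2)} ;
  lgs_one : forall p, lgs_dom (1%g, p) /\ lgs_act 1%g p = p ;
  lgs_inv : forall g p, lgs_dom (g, p) ->
    lgs_dom ((g^-1)%g, lgs_act g p) /\ lgs_act (g^-1)%g (lgs_act g p) = p ;
  lgs_mul : forall g h p,
    lgs_dom (h, p) -> lgs_dom (g, lgs_act h p) -> lgs_dom ((g * h)%g, p) ->
    lgs_act (g * h)%g p = lgs_act g (lgs_act h p) ;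
  lgs_local_homeo : forall p, exists V : set G,
    [/\ open V, V 1%g, (forall g, V g -> lgs_dom (g, p)) &
        exists W : set lgs_carrier,
          [/\ open W, W p & homeo_onto V W (fun g => lgs_act g p)]]
}.

Section local_spaces.
Context {R : realType} {G : topGroupType}.
Implicit Types (M : localGSpace G) (mG : {measure set (borel G) -> \bar R}).

Definition slice M (g : G) : set M := [set p | lgs_dom (g, p)].

(* [f] is a chart centered at [p] with domain [D] and range [V]. *)
Definition is_chart M (p : M) (D : set M) (V : set G) (f : M -> G) : Prop :=
  [/\ open D /\ D p, open V /\ V 1%g, homeo_onto D V f &
      forall g, V g ->
        [/\ lgs_dom (g, p), D (lgs_act g p) & f (lgs_act g p) = g]].

Definition canonical_measure mG M
    (vol : {measure set (borel M) -> \bar R}) : Prop :=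
  radon_measure vol /\
  forall (p : M) (D : set M) (V : set G) (f : M -> G), is_chart p D V f ->
    forall E : set (borel M), measurable E -> E `<=` D -> vol E = mG (f @` E).

(* M[U]. This set is Borel when [U] is open, so measures may be evaluated at
   it. *)
Definition good_points M (U : set G) : set M :=
  [set p |
    (forall g h, U g -> U h -> U (g * h)%g ->
      [/\ lgs_dom (h, p), lgs_dom (g, lgs_act h p), lgs_dom ((g * h)%g, p) &
          lgs_act g (lgs_act h p) = lgs_act (g * h)%g p]) /\
    (forall g, U g -> lgs_dom (g, p)) /\
    (exists W : set M,
      [/\ open W, W p & homeo_onto U W (fun g => lgs_act g p)])].

Definition sofic_approx_at M (vol : {measure set (borel M) -> \bar R})
    (U : set G) (eps : R) : Prop :=
  [/\ (0 < vol [set: M])%E, (vol [set: M] < +oo)%E &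
      ((1 - eps)%:E * vol [set: M] <= vol (@good_points M U))%E].

Definition completion M (gp : G * M) : M :=
  if pselect (lgs_dom gp) then lgs_act gp.1 gp.2 else gp.2.

Definition borel_completion M (L : G * M -> M) : Prop :=
  measurable_fun [set: borel (G * M)%type] (L : borel (G * M)%type -> borel M) /\
  forall g p, lgs_dom (g, p) -> L (g, p) = lgs_act g p.

End local_spaces.
Arguments slice {G} M g.
Arguments good_points {G} M U.

Record sofic_approximation (R : realType) (G : topGroupType)
    (mG : {measure set (borel G) -> \bar R}) := SoficApproximation {
  sofic_space :> nat -> localGSpace G ;
  sofic_vol : forall i, {measure set (borel (sofic_space i)) -> \bar R} ;
  sofic_vol_canonical : forall i, canonical_measure mG (sofic_vol i) ;
  sofic_approx : exists (U : nat -> set G) (eps : nat -> R),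
    [/\ (forall i, open (U i) /\ precompact (U i)),
        (forall i, U i `<=` U i.+1),
        \bigcup_i U i = [set: G],
        eps @ \oo --> 0 &
        forall i, sofic_approx_at (sofic_vol i) (U i) (eps i)]
}.

Definition sofic (R : realType) (G : topGroupType)
    (mG : {measure set (borel G) -> \bar R}) : Prop :=
  inhabited (sofic_approximation mG).

Section actions.
Context {R : realType} {G : topGroupType} {X : ptopologicalType}.

Record continuous_pmp_action (mu : probability (borel X) R)
    (act : G -> X -> X) : Prop := {
  action_one : forall x, act 1%g x = x ;
  action_mul : forall g h x, act (g * h)%g x = act g (act h x) ;
  action_continuous : continuous (fun gx : G * X => act gx.1 gx.2) ;
  action_preserving : forall g (E : set (borel X)), measurable E ->
    mu (act g @^-1` E) = mu E
}.

Definition generating (act : G -> X -> X) (rho : X -> X -> R) : Prop :=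
  forall x y, x <> y -> exists g, 0 < rho (act g x) (act g y).

End actions.

Section probabilities.
Context (R : realType) (X : ptopologicalType).

(* Prob(X) with the weak-star topology, i.e. the initial topology for the
   evaluations nu |-> \int f dnu, f in C(X). *)
Definition weak_star_prob :=
  initial_topology
    (fun nu : probability (borel X) R =>
       (fun f : continuousType X R => \int[nu]_x f x)
         : {ptws continuousType X R -> R}).

Definition basic_nbhs (mu : probability (borel X) R)
    (F : set (continuousType X R)) (eta : R) : set (probability (borel X) R) :=
  [set nu : probability (borel X) R | forall f, F f -> `|\int[nu]_x f x - \int[mu]_x f x| < eta].

End probabilities.

(* The supremum of the cardinals of the finite [eps]-separated subsets of [E]:
   0 if [E] is empty, and +oo if such subsets have unbounded cardinality. *)
Definition Sep (R : realType) (T : Type) (eps : R) (E : set T)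
    (d : T -> T -> R) : \bar R :=
  ereal_sup [set n%:R%:E | n in [set n | exists A : set T,
    [/\ A `<=` E, (A #= `I_n)%card &
        forall x y, A x -> A y -> x <> y -> eps < d x y]]].

Section entropy.
Context {R : realType} {G : topGroupType}.
Context {mG : {measure set (borel G) -> \bar R}}.
Context (Sigma : sofic_approximation mG) {X : ptopologicalType}.
Context (act : G -> X -> X) (mu : probability (borel X) R).
Context (rho : X -> X -> R).

(* vol_i / vol_i(M_i); the default value [dirac point] of [mnormalize] is not
   used, since 0 < vol_i(M_i) < +oo. *)
Definition volbar (i : nat) : probability (borel (Sigma i)) R :=
  mnormalize (sofic_vol Sigma i) (dirac point).

Local Notation maps i := {mfun borel (Sigma i) >-> borel X}.

Definition rho1 i (phi psi : maps i) : R :=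
  \int[volbar i]_p rho (phi p) (psi p).

Definition rho2 i (phi psi : maps i) : R :=
  Num.sqrt (\int[volbar i]_p (rho (phi p) (psi p)) ^+ 2).

(* vol_i(M_i)^-1 log Sep_eps(E, d) *)
Definition log_sep_rate i (eps : R) (E : set (maps i))
    (d : maps i -> maps i -> R) : \bar R :=
  ((fine (sofic_vol Sigma i [set: Sigma i]))^-1)%:E * lne (Sep eps E d).

Definition local_error i (phi : maps i) (g : G) : R :=
  fine (volbar i (~` slice (Sigma i) g)) +
  \int[volbar i]_(p in slice (Sigma i) g)
    rho (phi (lgs_act g p)) (act g (phi p)).

Definition local_maps i (U : set G) (delta : R)
    (O : set (probability (borel X) R)) : set (maps i) :=
  [set phi | (forall g, U g -> local_error phi g < delta) /\
             O (distribution (volbar i) phi)].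

Definition local_entropy_at (eps : R) : \bar R :=
  ereal_inf [set
    ereal_inf [set
      ereal_inf [set
        limn_esup (fun i => log_sep_rate eps (local_maps U delta O) (@rho1 i))
      | delta in [set delta : R | 0 < delta]]
    | U in precompact_open_nbhs1 G]
  | O in nbhs (mu : weak_star_prob R X)].

Definition local_entropy : \bar R := lim (local_entropy_at @ 0^'+).

Section Singh.
Context (L : forall i, G * Sigma i -> Sigma i).

Definition singh_error i (phi : maps i) (g : G) : R :=
  Num.sqrt (\int[volbar i]_p (rho (phi (L (g, p))) (act g (phi p))) ^+ 2).

Definition singh_maps i (U : set G) (delta : R)
    (F : set (continuousType X R)) : set (maps i) :=
  [set phi | (forall g, U g -> singh_error phi g < delta) /\
             basic_nbhs mu F delta (distribution (volbar i) phi)].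

Definition singh_entropy_at (eps : R) : \bar R :=
  ereal_inf [set
    ereal_inf [set
      ereal_inf [set
        limn_esup (fun i => log_sep_rate eps (singh_maps U delta F) (@rho2 i))
      | delta in [set delta : R | 0 < delta]]
    | U in precompact_open_nbhs1 G]
  | F in [set F : set (continuousType X R) | finite_set F]].

Definition singh_entropy : \bar R :=
  ereal_sup [set singh_entropy_at eps | eps in [set eps : R | 0 < eps < 1]].

End Singh.
End entropy.

(* Main.v *)
(** For [e] in [U] open, [M[U]] is a countable intersection of relatively open
    conditions, hence Borel: orbit maps are local homeomorphisms, so an
    injective orbit map on [U] is automatically a homeomorphism onto an open
    set, and [U] is sigma-compact. As [M_i[U_i]] lies in [M_i[g]] for [g] in
    [U_i], soficity makes [volbar(M_i \ M_i[g])] small uniformly over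
    precompact sets of [g]. Since [0 <= rho <= 1], Cauchy-Schwarz gives
    [rho1 <= rho2], [rho2^2 <= rho1], [E^S^2 <= E^B] and
    [E^B <= volbar(M_i \ M_i[g]) + E^S]. Hence the entropy at scale [r] in the
    local sense is at most Singh's at [r], which is at most the local one at
    [r^2]; the local one is monotone in [r], so the limits agree. The values of
    the completion off the domain only enter through [volbar(M_i \ M_i[g])]. *)

Require Import Defs.
From mathcomp Require Import all_boot all_order all_algebra finmap.
From mathcomp Require Import all_classical all_reals all_analysis.
From mathcomp Require Import measurable_realfun lra.
Import Order.TTheory GRing.Theory Num.Theory.
Import numFieldTopology.Exports numFieldNormedType.Exports.
Local Open Scope classical_set_scope.
Local Open Scope ring_scope.
Set Implicit Arguments.
Unset Strict Implicit.
Unset Printing Implicit Defensive.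

(** * Compact networks and Borel sets cut out by universally quantified open conditions *)

(* The [C n] are not required to be neighborhoods: this already makes every
   open set sigma-compact, and it passes to products at once. *)
Definition compact_network (T : topologicalType) (C : nat -> set T) : Prop :=
  (forall n, compact (C n)) /\
  (forall x (U : set T), nbhs x U -> exists n, C n x /\ C n `<=` U).

Lemma compact_networkP (T : topologicalType) :
  locally_compact [set: T] -> @second_countable T -> hausdorff_space T ->
  exists C : nat -> set T, compact_network C.
Proof.
move=> lcT [B /countable_injP[f finj] [Bopen Bbase]] hT.
pose V n := \bigcup_(U in [set U | B U /\ f U = n]) U.
have VE U : B U -> V (f U) = U.
  move=> BU; rewrite /V; apply/seteqP; split=> [x [W [BW fWU] Wx]|x Ux].
    by have <- : W = U by apply: (finj _ _ _ _ fWU); exact: mem_set.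
  by exists U.
pose C n := if `[< compact (closure (V n)) >] then closure (V n) else set0.
exists C; split=> [n|x U Ux].
  by rewrite /C; case: asboolP => // _; exact: compact0.
have [K] := lcT x I; rewrite withinET => Kx [cK clK].
(* A compact Hausdorff neighborhood is regular, so some base element at [x] has its closure inside
   [U] and [K]; that closure is compact, hence kept in [C]. *)
have /(_ (U `&` K)) := compact_regular hT cK Kx.
rewrite nbhs_filterE => /(_ (filterI Ux Kx))[W Wx clW].
have [A [BA Ax] AW] := Bbase x W Wx.
have clAUK : closure A `<=` U `&` K by apply: subset_trans clW; exact: closureS.
have cA : compact (closure A).
  apply: subclosed_compact cK _; first exact: closed_closure.
  by move=> y /clAUK [].
exists (f A); rewrite /C VE//; case: asboolP => // _; split.
  exact: subset_closure.
by move=> y /clAUK [].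
Qed.

Lemma compact_network_prod (S T : topologicalType) (C : nat -> set S)
    (D : nat -> set T) : compact_network C -> compact_network D ->
  exists E : nat -> set (S * T), compact_network E.
Proof.
move=> [cC nC] [cD nD].
pose E n := if (choice.unpickle n : option (nat * nat)) is Some (i, j)
            then C i `*` D j else set0.
exists E; split=> [n|[x y] U [[/= A1 A2] [A1x A2y] AU]].
  rewrite /E; case: (choice.unpickle n) => [[i j]|]; last exact: compact0.
  exact: compact_setX.
have [i [Cx CA]] := nC _ _ A1x; have [j [Dy DA]] := nD _ _ A2y.
exists (choice.pickle (i, j)); rewrite /E choice.pickleK.
split=> // -[a b] [/= Ca Db].
by apply: AU; split; [exact: CA|exact: DA].
Qed.

Lemma borel_open (T : ptopologicalType) (O : set (borel T)) :
  open (O : set T) -> measurable O.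
Proof. exact: sub_sigma_algebra. Qed.

(* For a compact piece [K] of [N] the condition "for all t in K" is relatively
   open in [A] (tube lemma); [N] is a countable union of such pieces. *)
Lemma measurable_forall_open (S : topologicalType) (T : ptopologicalType)
    (C : nat -> set S) (N : set S) (A : set (borel T)) (Q : S -> T -> Prop) :
  compact_network C -> open N -> measurable A ->
  (forall t p, N t -> A p -> Q t p ->
     \forall t' \near t & p' \near (p : T), N t' -> A p' -> Q t' p') ->
  measurable (A `&` [set p | forall t, N t -> Q t p] : set (borel T)).
Proof.
move=> [cC nC] oN mA nearQ.
(* The guard [C n <= N] makes the condition vacuous for pieces not contained in [N], and the guard
   [A p] turns relative openness in [A] into openness. *)
pose O n : set T :=
  interior [set p | C n `<=` N -> A p -> forall t, C n t -> Q t p].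
rewrite [X in measurable X](_ : _ = A `&` \bigcap_n O n).
  apply: measurableI => //; apply: bigcapT_measurable => n.
  by apply: borel_open; exact: open_interior.
apply/seteqP; split=> p [Ap Qp]; split=> //; last first.
  move=> t Nt; have [n [Ct CN]] := nC t N (open_nbhs_nbhs (conj oN Nt)).
  by have /interior_subset /(_ CN Ap t Ct) := Qp n I.
move=> n _; rewrite /O /interior /=.
have [CN|nCN] := pselect (C n `<=` N); last by apply: nearW => q /nCN.
have /compact_near_coveringP cover_n := cC n.
have : \forall q \near p, C n `<=` (fun t => A q -> Q t q).
  apply: cover_n => t Ct.
  have Nt : \forall t' \near t & q \near p, N t'.
    exists (N, setT) => /=; last by move=> -[? ?] [].
    by split; [apply: open_nbhs_nbhs; split=> //; exact: CN|exact: filterT].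
  have Qt := nearQ t p (CN _ Ct) Ap (Qp _ (CN _ Ct)).
  by apply: filterS (filterI Nt Qt) => z [Nz /(_ Nz)].
by apply: filterS => q h _ Aq t Ct; exact: h.
Qed.

(** * Borel measurability of M[U] *)

Section good_points.
Context {G : topGroupType}.
Implicit Types M : localGSpace G.

Lemma lgs_act_cvg M (g : G) (p : M) : lgs_dom (g, p) ->
  (fun z : G * M => lgs_act z.1 z.2) @ (g, p) --> lgs_act g p.
Proof.
move=> d; have := @lgs_continuous _ M.
rewrite continuous_open_subspace; last exact: lgs_dom_open.
by move/(_ (g, p) (mem_set d)).
Qed.

(** With [f] the inverse of the local homeomorphism at q = g.p, the section is s(z) = f(z)g, because
    (f(z)g).p = f(z).(g.p) = z near q. *)
Lemma orbit_local_section M (U : set G) (p : M) (g : G) :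
  open U -> (forall h, U h -> lgs_dom (h, p)) -> U g ->
  exists s : M -> G, s @ lgs_act g p --> g /\
    \forall z \near lgs_act g p, U (s z) /\ lgs_act (s z) p = z.
Proof.
move=> oU Udom Ug; set q := lgs_act g p.
have [V [oV V1 Vdom [W [oW Wq [f [_ cf fV fW]]]]]] := lgs_local_homeo q.
have f1 : f q = 1%g by have := (fV _ V1).2; rewrite (lgs_one q).2.
have cs : (fun z => f z * g)%g @ q --> g.
  rewrite -[X in _ --> X](mul1g g).
  apply: (@continuous2_cvg _ G G G (nbhs q) _ f (fun=> g)
    (fun a b => (a * b)%g)).
  - exact: (@mulg_continuous G (1%g, g)).
  - move: cf; rewrite continuous_open_subspace// => /(_ q (mem_set Wq)).
    by rewrite /continuous_at f1.
  - exact: cvg_cst.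
exists (fun z => f z * g)%g; split=> //.
have nU : \forall z \near q, U (f z * g)%g.
  by apply: cs; exact: open_nbhs_nbhs.
have nW : nbhs q W by exact: open_nbhs_nbhs.
apply: filterS (filterI nU nW) => z [Uz Wz]; split=> //.
have [Vz fz] := fW _ Wz.
rewrite lgs_mul//; [exact: Udom|exact: Vdom|exact: Udom].
Qed.

(** Local sections make the image open, and by injectivity they coincide near each point with the
    global inverse, which is therefore continuous. *)
Lemma orbit_homeo M (U : set G) (p : M) :
  open U -> (forall h, U h -> lgs_dom (h, p)) ->
  (forall g h, U g -> U h -> lgs_act g p = lgs_act h p -> g = h) ->
  let W := (fun g => lgs_act g p) @` U in
  open W /\ homeo_onto U W (fun g => lgs_act g p).
Proof.
move=> oU Udom inj W.
have oW : open W.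
  rewrite openE => _ [g Ug <-].
  have [s [_ ns]] := orbit_local_section oU Udom Ug.
  by apply: filterS ns => z [Usz <-]; exists (s z).
split=> //.
pose f z := xget 1%g [set g | U g /\ lgs_act g p = z].
have fK g : U g -> f (lgs_act g p) = g.
  move=> Ug; rewrite /f; case: xgetP => [h _ [Uh]|/(_ g)]; first exact: inj.
  by case.
exists f; split.
- rewrite continuous_open_subspace// => g /set_mem Ug.
  apply: (@continuous2_cvg _ G M M (nbhs g) _ id (fun=> p) (@lgs_act _ M)).
  + exact/lgs_act_cvg/Udom.
  + exact: cvg_id.
  + exact: cvg_cst.
- rewrite continuous_open_subspace// => z /set_mem [g Ug <-].
  have [s [cs ns]] := orbit_local_section oU Udom Ug.
  rewrite /continuous_at fK//; apply: cvg_trans cs; apply: near_eq_cvg.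
  by apply: filterS ns => y [Us sy]; rewrite -{2}sy fK.
- by move=> g Ug; split; [exists g|exact: fK].
- by move=> _ [g Ug <-]; rewrite fK.
Qed.

(** The homeomorphism clause reduces to injectivity by [orbit_homeo], and the product rule to
    definedness by [lgs_mul]. Each remaining condition is universal over an open parameter set, the
    form that [measurable_forall_open] handles. *)
Lemma good_pointsE M (U : set G) : open U -> U 1%g ->
  good_points M U = [set p | forall g, U g -> lgs_dom (g, p)]
    `&` [set p | forall gh : G * G,
          [/\ U gh.1, U gh.2 & U (gh.1 * gh.2)%g] ->
          lgs_dom (gh.1, lgs_act gh.2 p)]
    `&` [set p | forall gh : G * G, [/\ U gh.1, U gh.2 & gh.1 != gh.2] ->
          lgs_act gh.1 p != lgs_act gh.2 p].
Proof.
move=> oU U1; apply/seteqP; split=> p.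
  move=> [assoc [dom [W [oW Wp [f [_ _ fU _]]]]]]; split; [split=> //|].
    by move=> [g h] [/= Ug Uh Ugh]; have [] := assoc g h Ug Uh Ugh.
  move=> [g h] [/= Ug Uh]; apply: contra_neq => eq.
  by rewrite -(fU _ Ug).2 eq (fU _ Uh).2.
move=> [[dom dom2] inj]; split; [|split=> //].
  move=> g h Ug Uh Ugh; have d := dom2 (g, h) (And3 Ug Uh Ugh).
  by split=> //; [exact: dom|exact: dom|rewrite lgs_mul//; exact: dom].
have inj' g h : U g -> U h -> lgs_act g p = lgs_act h p -> g = h.
  move=> Ug Uh; apply: contraPeq => gh.
  exact/eqP/(inj (g, h) (And3 Ug Uh gh)).
have [oW hW] := orbit_homeo oU dom inj'.
exists ((fun g => lgs_act g p) @` U); split=> //.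
by exists 1%g => //; exact: (lgs_one p).2.
Qed.

Hypotheses (lcG : locally_compact [set: G]) (scG : @second_countable G).
Hypothesis hG : hausdorff_space G.

(** The three conditions are treated as nested: the second and third are open only relative to the
    points where all of [U] acts, so [measurable_forall_open] is applied with the earlier conditions
    as the ambient set [A]. *)
Lemma measurable_good_points M (U : set G) : open U -> U 1%g ->
  measurable (good_points M U : set (borel M)).
Proof.
move=> oU U1; rewrite good_pointsE//.
have [C nC] := compact_networkP lcG scG hG.
have [E nE] := compact_network_prod nC nC.
have oU1 : open [set gh : G * G | U gh.1].
  exact: (open_comp (fun z _ => @cvg_fst _ _ _ _ _)).
have oU2 : open [set gh : G * G | U gh.2].
  exact: (open_comp (fun z _ => @cvg_snd _ _ _ _ _)).
have oUU : open [set gh : G * G | U (gh.1 * gh.2)%g].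
  exact: (open_comp (fun z _ => @mulg_continuous G z)).
have cact (F : G * G -> G) (z : G * G) (p : M) :
    F @ z --> F z -> lgs_dom (F z, p) ->
    (fun y : (G * G) * M => lgs_act (F y.1) y.2) @ (z, p) --> lgs_act (F z) p.
  move=> cF d; apply: (@continuous2_cvg _ G M M (nbhs (z, p)) _
    (fun y => F y.1) snd (@lgs_act _ M)).
  - exact: lgs_act_cvg.
  - exact: (cvg_comp _ _ (@cvg_fst _ _ _ _ _) cF).
  - exact: cvg_snd.
have cfst (z : G * G) : fst @ z --> z.1 by exact: cvg_fst.
have csnd (z : G * G) : snd @ z --> z.2 by exact: cvg_snd.
apply: (measurable_forall_open nE).
(* The set of pairs of distinct elements is open because [G] is Hausdorff. *)
- rewrite [X in open X](_ : _ = [set gh : G * G | U gh.1]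
      `&` [set gh : G * G | U gh.2] `&` [set gh : G * G | gh.1 != gh.2]).
    apply: openI; first exact: openI.
    rewrite openE => -[g h] /= gh; have := hG; rewrite open_hausdorff.
    move=> /(_ _ _ gh)[[A B] /= [/set_mem Ag /set_mem Bh] [oA oB /eqP AB0]].
    exists (A, B) => /=.
      by split; exact: open_nbhs_nbhs.
    move=> [a b] [/= Aa Bb]; apply/eqP => ab.
    suff : (A `&` B) a by rewrite AB0.
    by split=> //; rewrite ab.
  by apply/seteqP; split=> gh /= [] => [|[]].
- apply: (measurable_forall_open nE).
  + rewrite [X in open X](_ : _ = [set gh : G * G | U gh.1]
        `&` [set gh : G * G | U gh.2] `&` [set gh : G * G | U (gh.1 * gh.2)%g]).
      by apply: openI => //; exact: openI.
    by apply/seteqP; split=> gh /= [] => [|[]].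
  + rewrite -[X in measurable X]setTI; apply: (measurable_forall_open nC) => //.
    move=> g p _ _ d; rewrite /= in d.
    have : nbhs (g, p) (@lgs_dom _ M).
      by apply: open_nbhs_nbhs; split=> //; exact: lgs_dom_open.
    by apply: filterS => -[].
  + move=> [g h] p /= [Ug Uh Ugh] dom d.
    have : (fun y : (G * G) * M => (y.1.1, lgs_act y.1.2 y.2)) @ ((g, h), p)
        --> (g, lgs_act h p).
      apply: cvg_pair => /=.
        exact: (cvg_comp _ _ (@cvg_fst _ _ _ _ _) (cfst (g, h))).
      by apply: (cact snd) => //; exact: dom.
    have nd : nbhs (g, lgs_act h p) (@lgs_dom _ M).
      by apply: open_nbhs_nbhs; split=> //; exact: lgs_dom_open.
    move=> /(_ _ nd) near_d.
    have {}near_d : \forall y \near ((g, h), p : M),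
        lgs_dom (y.1.1, lgs_act y.1.2 y.2) by exact: near_d.
    by apply: filterS near_d => -[[a b] q] /=.
(* Disjoint neighborhoods of g.p and h.p in the Hausdorff space [M], pulled back along the
   continuous action, keep the two images distinct nearby. *)
- move=> [g h] p /= [Ug Uh gh] [dom _] neq.
  have := @lgs_hausdorff _ M; rewrite open_hausdorff => /(_ _ _ neq).
  move=> [[A B] /= [/set_mem Ag /set_mem Bh] [oA oB /eqP AB0]].
  have nA : \forall y \near ((g, h), p : M), A (lgs_act y.1.1 y.2).
    exact: (cact fst (g, h) p (cfst (g, h)) (dom _ Ug) _
      (open_nbhs_nbhs (conj oA Ag))).
  have nB : \forall y \near ((g, h), p : M), B (lgs_act y.1.2 y.2).
    exact: (cact snd (g, h) p (csnd (g, h)) (dom _ Uh) _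
      (open_nbhs_nbhs (conj oB Bh))).
  apply: filterS (filterI nA nB) => -[[a b] q] [/= Aa Bb] _ _.
  apply/eqP => ab.
  suff : (A `&` B) (lgs_act a q) by rewrite AB0.
  by split=> //; rewrite ab.
Qed.
End good_points.

(** * Measurability of the pseudometric between two measurable maps *)

Lemma continuous_partial (S T U : topologicalType) (h : S -> T -> U) (s : S) :
  continuous (fun z : S * T => h z.1 z.2) -> continuous (h s).
Proof.
move=> ch t; apply: (@continuous2_cvg _ S T U (nbhs t) _ (fun=> s) id h).
- exact: (ch (s, t)).
- exact: cvg_cst.
- exact: cvg_id.
Qed.

Lemma compact_finite_net (R : realType) (X : ptopologicalType)
    (rho : X -> X -> R) :
  compact [set: X] -> is_pseudometric rho ->
  continuous (fun xy : X * X => rho xy.1 xy.2) ->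
  forall e, 0 < e -> exists D : set X, finite_set D /\
    forall x, exists2 y, D y & rho y x < e.
Proof.
move=> cX [_ rxx _ _] crho e e0.
move: cX; rewrite compact_cover => /(_ X setT (fun y => [set x | rho y x < e])).
have crhoy y : continuous (rho y) by exact: continuous_partial.
case=> [y _|x _|D _ Dcov].
- apply: (@open_comp _ _ (rho y) [set r | r < e]) => [x _|]; first exact: crhoy.
  exact: open_lt.
- by exists x => //=; rewrite rxx.
- exists [set` D]; split=> // x.
  by have [y Dy ryx] := Dcov x I; exists y.
Qed.

Lemma borel_measurable_comp d (T : measurableType d) (X Y : ptopologicalType)
    (D : set T) (f : T -> X) (h : X -> Y) :
  measurable_fun D (f : T -> borel X) -> continuous h ->
  measurable_fun D (h \o f : T -> borel Y).
Proof.
move=> mf /continuousP ch mD; move: (mD).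
apply: (@measurability _ _ T (borel Y) D (h \o f) (@open Y)) => //.
by move=> _ [V oV <-]; apply: (mf mD (h @^-1` V)); apply: borel_open; exact: ch.
Qed.

(* [p |-> (a p, b p)] need not be Borel a priori, so [rho (a p) (b p) < r] is
   expressed by one-variable conditions at the points of finite nets of [X]. *)
Lemma measurable_pseudometric (R : realType) (X : ptopologicalType)
    (rho : X -> X -> R) d (T : measurableType d) (D : set T) (a b : T -> X) :
  compact [set: X] -> is_pseudometric rho ->
  continuous (fun xy : X * X => rho xy.1 xy.2) ->
  measurable_fun D (a : T -> borel X) -> measurable_fun D (b : T -> borel X) ->
  measurable_fun D (fun p => rho (a p) (b p)).
Proof.
move=> cX prho crho ma mb mD.
have [_ _ rsym rtri] := prho.
have crhoy y : continuous (rho y) by exact: continuous_partial.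
have mrho (c : T -> X) y : measurable_fun D (c : T -> borel X) ->
    measurable_fun D (fun p => rho y (c p)).
  move=> mc; apply: (measurability _ (RGenInftyO.measurableE R)).
  move=> _ [_ [r ->] <-].
  apply: (mc mD (rho y @^-1` `]-oo, r[)); apply: borel_open.
  by move/continuousP : (crhoy y); apply; exact: interval_open.
have net k : exists D : set X, finite_set D /\
    forall x, exists2 y, D y & rho y x < k.+1%:R^-1.
  by apply: (compact_finite_net cX prho crho); rewrite invr_gt0.
have [N Nnet] := boolp.choice net.
move: (mD); apply: (measurability _ (RGenInftyO.measurableE R)).
move=> _ [_ [r ->] <-].
(* [N k] is a finite net of radius 1/(k+1). The inclusion from right to left is the triangle
   inequality through [y]. *)
rewrite [X in measurable X](_ : _ = \bigcup_k \bigcup_(y in N k)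
   (D `&` (fun p => rho y (a p) + rho y (b p)) @^-1` `]-oo, r[)).
  apply: bigcupT_measurable => k; apply: fin_bigcup_measurable => [|y _].
    exact: (Nnet k).1.
  have mab : measurable_fun D (fun p => rho y (a p) + rho y (b p)).
    by apply: measurable_funD; [exact: mrho ma|exact: mrho mb].
  by apply: (mab mD); exact: measurable_itv.
apply/seteqP; split=> p.
  move=> [Dp]; rewrite /= in_itv/= => rab.
  (* If rho(y, a p) < e, then rho(y, a p) + rho(y, b p) < 2e + rho(a p, b p), which equals r for
     this value of e. *)
  have e0 : 0 < (r - rho (a p) (b p)) / 2 by lra.
  have [k] := ltr_add_invr e0; rewrite add0r => kr.
  have [y Ny ya] := (Nnet k).2 (a p).
  exists k => //; exists y => //; split=> //=; rewrite in_itv/=.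
  by have := lt_trans ya kr; have := rtri y (a p) (b p); move: rab; clear; lra.
move=> [k _ [y _ [Dp]]]; rewrite /= !in_itv/= => h; split=> //.
by apply: le_lt_trans h; rewrite [rho y (a p)]rsym.
Qed.

(** * Integral inequalities for functions with values in [0,1] *)

Section probability_integrals.
Context d (T : measurableType d) (R : realType) (P : probability T R).
Implicit Types (D : set T) (f : T -> R).

Lemma prob_integrable D f : measurable D -> measurable_fun D f ->
  (forall x, D x -> 0 <= f x <= 1) -> P.-integrable D (EFin \o f).
Proof.
move=> mD mf f01; apply: measurable_bounded_integrable => //.
  by apply: (@le_lt_trans _ _ 1%E); [exact: probability_le1|exact: ltry].
exists 1; split=> [|M M1 x Dx]; first exact: num_real.
have /andP[f0 f1] := f01 x Dx; rewrite /= ger0_norm//.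
exact: le_trans f1 (ltW M1).
Qed.

Lemma sqr01 (r : R) : 0 <= r <= 1 -> 0 <= r ^+ 2 <= 1.
Proof. by move=> r01; rewrite expr2; nra. Qed.

Lemma sqr_le_id (r : R) : 0 <= r <= 1 -> r ^+ 2 <= r.
Proof. by move=> r01; rewrite expr2; nra. Qed.

Variables (f : T -> R) (mf : measurable_fun setT f).
Hypothesis f01 : forall x, 0 <= f x <= 1.

Let if1 : P.-integrable setT (EFin \o f).
Proof. exact: prob_integrable. Qed.

Let if2 : P.-integrable setT (EFin \o (fun x => f x ^+ 2)).
Proof.
apply: prob_integrable => //; first exact: measurable_funX.
by move=> x _; exact: sqr01.
Qed.

Lemma Rintegral_sqr_le : \int[P]_x (f x ^+ 2) <= \int[P]_x f x.
Proof. by apply: le_Rintegral => // x _; exact: sqr_le_id. Qed.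

(** Cauchy-Schwarz against the constant 1, obtained by integrating 2cf <= f^2 + c^2 with c the mean
    of f. *)
Lemma Rintegral_le_sqrt : \int[P]_x f x <= Num.sqrt (\int[P]_x (f x ^+ 2)).
Proof.
set c := \int[P]_x f x.
have c0 : 0 <= c by apply: Rintegral_ge0 => x _; case/andP: (f01 x).
have ic : P.-integrable setT (EFin \o cst (c ^+ 2)).
  apply: measurable_bounded_integrable => //.
    by apply: (@le_lt_trans _ _ 1%E); [exact: probability_le1|exact: ltry].
  exact: bounded_cst.
have ifc : P.-integrable setT (EFin \o (fun x => 2 * c * f x)).
  have := integrableZl (@measurableT _ T) (2 * c) if1.
  by apply: eq_integrable.
have : \int[P]_x (2 * c * f x) <= \int[P]_x (f x ^+ 2 + c ^+ 2).
  apply: le_Rintegral => //.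
    have := integrableD (@measurableT _ T) if2 ic.
    by apply: eq_integrable.
  by move=> x _; have := sqr_ge0 (f x - c); rewrite !expr2; nra.
rewrite RintegralZl// RintegralD// Rintegral_cst//.
rewrite -/c [X in c ^+ 2 * X](_ : _ = 1); last first.
  by have /(congr1 fine) := probability_setT P.
rewrite mulr1 => h.
rewrite -[leLHS](ger0_norm c0) -sqrtr_sqr; apply: ler_wsqrtr.
by move: h; rewrite !expr2; lra.
Qed.

(** Used with [S] = M_i[g] to pass between the local error, integrated over the slice, and Singh's
    error, integrated over all of M_i. *)
Lemma Rintegral_split_le (S : set T) : measurable S ->
  \int[P]_(x in S) f x <= \int[P]_x f x <=
  \int[P]_(x in S) f x + fine (P (~` S)).
Proof.
move=> mS; have mSC : measurable (~` S) by exact: measurableC.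
have split : \int[P]_x f x = \int[P]_(x in S) f x + \int[P]_(x in ~` S) f x.
  rewrite -Rintegral_setU//; first by rewrite setUCr.
    by rewrite setUCr.
  by apply/disj_setPS; rewrite setICr.
have h0 : 0 <= \int[P]_(x in ~` S) f x.
  by apply: Rintegral_ge0 => x _; case/andP: (f01 x).
have h1 : \int[P]_(x in ~` S) f x <= fine (P (~` S)).
  rewrite -[leRHS]mul1r -Rintegral_cst//; apply: le_Rintegral => //.
  - by apply: (integrableS _ _ _ if1).
  - by apply: prob_integrable => // x _; rewrite lexx ler01.
  - by move=> x _; case/andP: (f01 x).
by rewrite split; apply/andP; split; lra.
Qed.
End probability_integrals.

(** * Basic weak-star neighborhoods *)

Section weak_star.
Context {R : realType} {X : ptopologicalType}.
Implicit Types (mu : probability (borel X) R) (F : set (continuousType X R)).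

Lemma nbhs_basic_nbhs mu F (eta : R) : finite_set F -> 0 < eta ->
  nbhs (mu : weak_star_prob R X) (basic_nbhs mu F eta).
Proof.
move=> finF eta0; pose ev (nu : weak_star_prob R X) :
  {ptws continuousType X R -> R} := fun f => \int[nu]_x f x.
have cev : continuous ev by exact: initial_continuous.
have near_f (f : continuousType X R) : nbhs (mu : weak_star_prob R X)
    [set nu : probability (borel X) R |
      `|\int[nu]_x f x - \int[mu]_x f x| < eta].
  have cf : (fun nu => ev nu f) @ (mu : weak_star_prob R X) --> ev mu f.
    have pc := @proj_continuous _ (fun _ : continuousType X R => R) f (ev mu).
    exact: (cvg_comp _ _ (cev mu) pc).
  move/cvgrPdist_lt : cf => /(_ _ eta0); apply: filterS => nu /=.
  by rewrite distrC.
move: finF => /finite_fsetP[D ->].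
have FF : Filter (nbhs (mu : weak_star_prob R X)) := nbhs_filter _.
have cap : nbhs (mu : weak_star_prob R X) (\bigcap_(f in [set` D])
    [set nu : probability (borel X) R |
      `|\int[nu]_x (f : continuousType X R) x - \int[mu]_x f x| < eta]).
  by apply: filter_bigI => f _; exact: near_f.
by apply: (filterS _ cap) => nu h f Ff; exact: h.
Qed.

(** The filter [Phi] generated by the basic neighborhoods converges to mu after evaluation at each
    f, hence in the pointwise topology. The topology on measures being initial for the evaluations,
    every neighborhood of mu then belongs to [Phi]. *)
Lemma nbhs_weak_starP mu (O : set (probability (borel X) R)) :
  nbhs (mu : weak_star_prob R X) O -> exists F (eta : R),
    [/\ finite_set F, 0 < eta & basic_nbhs mu F eta `<=` O].
Proof.
pose dom := [set p : set (continuousType X R) * R | finite_set p.1 /\ 0 < p.2].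
pose Phi := filter_from dom (fun p => basic_nbhs mu p.1 p.2).
have Phi_filter : Filter Phi.
  apply: filter_from_filter; first by exists (set0, 1).
  move=> [F1 e1] [F2 e2] [/= finF1 e10] [/= finF2 e20].
  exists (F1 `|` F2, Num.min e1 e2) => /=.
    by split=> /=; [rewrite finite_setU|rewrite lt_min e10].
  move=> nu h; split=> f Ff; have := h f.
    by rewrite lt_min => /(_ (or_introl Ff))/andP[].
  by rewrite lt_min => /(_ (or_intror Ff))/andP[].
pose ev (nu : weak_star_prob R X) :
  {ptws continuousType X R -> R} := fun f => \int[nu]_x f x.
have Phi_f (f : continuousType X R) :
    (fun nu : probability (borel X) R => \int[nu]_x f x) @ Phi
      --> \int[mu]_x f x.
  apply/cvgrPdist_lt => e e0; exists ([set f], e) => /=.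
    by split=> //; exact: finite_set1.
  by move=> nu /(_ f erefl); rewrite distrC.
have Phi_ev : {ptws, ev @ Phi --> ev mu}.
  apply/cvg_sup => f A; rewrite nbhsE => -[B [[C oC <-] Cf] BA].
  have PhiC : Phi [set nu : probability (borel X) R | C (\int[nu]_x f x)].
    exact: Phi_f f C (open_nbhs_nbhs (conj oC Cf)).
  have : Phi (ev @^-1` A) by apply: filterS PhiC => nu Cnu; exact: BA.
  by [].
move=> [_ [[A oA <-] Amu] AO].
have [[F e] [/= finF e0] FA] : Phi (ev @^-1` A).
  by apply: Phi_ev; exact: open_nbhs_nbhs.
by exists F, e; split=> //; apply: subset_trans AO.
Qed.
End weak_star.

(** * Limits superior, separation numbers and exhaustions *)

Lemma le_limn_esup (R : realType) (u v : (\bar R)^nat) :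
  (\forall n \near \oo, (u n <= v n)%E) -> (limn_esup u <= limn_esup v)%E.
Proof.
move=> uv; rewrite /limn_esup !limf_esupE.
apply: le_ereal_inf_tmp => _ [V nV <-].
(* The limit superior is an infimum of suprema over cofinal sets, so each [V] may be cut down to the
   indices where the inequality holds. *)
apply: (@le_trans _ _ (ereal_sup (u @` (V `&` [set n | (u n <= v n)%E])))).
  apply: ereal_inf_lbound; exists (V `&` [set n | (u n <= v n)%E]) => //.
  exact: filterI.
apply: ge_ereal_sup => _ [n [Vn /= uvn] <-].
by apply: le_trans uvn _; apply: ereal_sup_ubound; exists n.
Qed.

Section separation.
Context {R : realType} {T : Type}.
Implicit Types (E : set T) (d : T -> T -> R) (e : R).

Lemma le_Sep e e' E E' d d' : E `<=` E' ->
  (forall x y, e < d x y -> e' < d' x y) -> (Sep e E d <= Sep e' E' d')%E.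
Proof.
move=> EE' dd'; apply: ereal_sup_le => _ [n [A [AE An sepA]] <-].
exists n => //; exists A; split=> //; first exact: subset_trans EE'.
by move=> x y Ax Ay xy; apply: dd'; exact: sepA.
Qed.

Lemma Sep_ge0 e E d : (0 <= Sep e E d)%E.
Proof.
apply: ereal_sup_ubound; exists 0%N => //; exists set0; split=> //.
by rewrite II0.
Qed.
End separation.

(** Compactness of the closure gives an inclusion from some rank on, because the open sets [V i]
    increase. *)
Lemma near_precompact_subset (G : topologicalType) (U : set G)
    (V : nat -> set G) :
  precompact U -> (forall i, open (V i)) -> (forall i, V i `<=` V i.+1) ->
  \bigcup_i V i = [set: G] -> \forall i \near \oo, U `<=` V i.
Proof.
rewrite precompactE => /compact_near_coveringP cU oV incV cov.
have mono m n : (m <= n)%N -> V m `<=` V n.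
  move=> /subnK <-; elim: (n - m)%N => // k IH; apply: subset_trans IH _.
  exact: incV.
have : \forall i \near \oo, closure U `<=` V i.
  apply: (cU nat \oo V) => g _.
  have [m _ Vmg] : (\bigcup_i V i) g by rewrite cov.
  exists (V m, [set n | (m <= n)%N]) => /=.
    by split; [exact: open_nbhs_nbhs|exists m].
  by move=> [h n] [/= Vh mn]; exact: mono mn _ Vh.
by apply: filterS => i UV; apply: subset_trans UV; exact: subset_closure.
Qed.

(** * The slices M[g] and the measurable sections of completions *)

Section slices.
Context {G : topGroupType}.
Implicit Types M : localGSpace G.

Lemma slice_open M (g : G) : open (slice M g).
Proof.
have cg : continuous (fun p : M => (g, p)).
  by move=> p; apply: cvg_pair; [exact: cvg_cst|exact: cvg_id].
apply: (@open_comp _ _ (fun p : M => (g, p)) (@lgs_dom _ M)) => [p _|].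
  exact: cg.
exact: lgs_dom_open.
Qed.

Lemma measurable_slice M (g : G) : measurable (slice M g : set (borel M)).
Proof. by apply: borel_open; exact: slice_open. Qed.

Lemma measurable_lgs_act M (g : G) :
  measurable_fun (slice M g : set (borel M)) (lgs_act g : borel M -> borel M).
Proof.
move=> mS; move: (mS).
apply: (@measurability _ _ (borel M) (borel M) _ (lgs_act g) (@open M)) => //.
move=> _ [V oV <-]; apply: borel_open; rewrite openE => p [/= Sp Vp].
have nS : nbhs p (slice M g).
  by apply: open_nbhs_nbhs; split=> //; exact: slice_open.
have cact : lgs_act g @ (p : M) --> lgs_act g p.
  apply: (@continuous2_cvg _ G M M (nbhs p) _ (fun=> g) id (@lgs_act _ M)).
  - exact: lgs_act_cvg.
  - exact: cvg_cst.
  - exact: cvg_id.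
exact: filterI nS (cact _ (open_nbhs_nbhs (conj oV Vp))).
Qed.

Lemma measurable_completion M (g : G) :
  measurable_fun setT (fun p : borel M => @completion G M (g, p) : borel M).
Proof.
rewrite -(setUv (slice M g)); apply/measurable_funU.
- exact: measurable_slice.
- by apply: measurableC; exact: measurable_slice.
split.
- apply: eq_measurable_fun (@measurable_lgs_act M g) => p /set_mem Sp.
  by rewrite /completion; destruct (pselect _).
- apply: (@eq_measurable_fun _ _ _ _ _ idfun) => [p /set_mem Sp|].
    by rewrite /completion; destruct (pselect _).
  exact: measurable_id.
Qed.

(** Measurability of [L] refers to the Borel sets of the product topology, so it is composed with
    the continuous embedding p -> (g,p). *)
Lemma measurable_borel_completion M (L : G * M -> M) (g : G) :
  borel_completion L ->
  measurable_fun setT (fun p : borel M => L (g, p) : borel M).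
Proof.
move=> [mL _].
have mpair : measurable_fun setT
    (fun p : borel M => (g, p : M) : borel (G * M)%type).
  have cpair : continuous (fun p : M => (g, p)).
    by move=> p; apply: cvg_pair; [exact: cvg_cst|exact: cvg_id].
  apply: (@measurability _ _ (borel M) (borel (G * M)%type) setT _
    (@open (G * M)%type)) => // _ [V oV <-].
  rewrite setTI; apply: borel_open.
  by move/continuousP : cpair => /(_ _ oV).
exact: measurableT_comp mL mpair.
Qed.
End slices.

(** * Soficity makes the complements of slices small *)

Section sofic_volumes.
Context {R : realType} {G : topGroupType}.
Context {mG : {measure set (borel G) -> \bar R}}.
Hypotheses (lcG : locally_compact [set: G]) (scG : @second_countable G).
Hypothesis hG : hausdorff_space G.
Variable Sigma : sofic_approximation mG.

(** M[U] lies in M[g] for g in [U]; monotonicity of the measure applies because M[U] is Borel. *)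
Lemma volbar_sliceC_le i (U : set G) (eps : R) (g : G) :
  open U -> U 1%g -> U g -> sofic_approx_at (sofic_vol Sigma i) U eps ->
  fine (volbar Sigma i (~` slice (Sigma i) g)) <= eps.
Proof.
move=> oU U1 Ug [vol_gt0 vol_fin vol_good].
set m := sofic_vol Sigma i in vol_gt0 vol_fin vol_good.
have mS := @measurable_slice G (Sigma i) g.
have mgood := measurable_good_points lcG scG hG (M := Sigma i) oU U1.
have fin_vol : m setT \is a fin_num by rewrite ge0_fin_numE// ltW.
have fvol : 0 < fine (m setT) by rewrite fine_gt0// vol_gt0.
have sub : (m (good_points (Sigma i) U) <= m (slice (Sigma i) g))%E.
  by apply: le_measure; rewrite ?inE// => p [_ [dom _]]; exact: dom.
have PS : ((1 - eps)%:E <= volbar Sigma i (slice (Sigma i) g))%E.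
  (* The total volume is neither 0 nor infinite, so the default branch of [mnormalize] is
     excluded. *)
  rewrite /volbar/= /mnormalize ifF; last first.
    by apply/negbTE; rewrite negb_or gt_eqF//= lt_eqF.
  rewrite lee_pdivlMr// fineK//.
  exact: le_trans vol_good sub.
rewrite probability_setC//.
have finS : volbar Sigma i (slice (Sigma i) g) \is a fin_num.
  exact: fin_num_measure.
move: PS; rewrite fineB//= -[X in (_ <= X)%E -> _](fineK finS) lee_fin.
lra.
Qed.

(** The rank is uniform in g: it depends only on when [U] enters the exhaustion and when the
    tolerances drop below [e]. *)
Lemma volbar_sliceC_near (U : set G) (e : R) : precompact_open_nbhs1 G U ->
  0 < e -> \forall i \near \oo, forall g, U g ->
    fine (volbar Sigma i (~` slice (Sigma i) g)) < e.
Proof.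
move=> [oU pU U1] e0.
have [V [eps [oV incV covV eps0 appV]]] := sofic_approx Sigma.
have nU := near_precompact_subset pU (fun i => (oV i).1) incV covV.
have neps : \forall i \near \oo, eps i < e.
  have /cvgrPdist_lt/(_ _ e0) := eps0.
  by apply: filterS => i; rewrite sub0r normrN; exact: le_lt_trans (ler_norm _).
apply: filterS (filterI nU neps) => i [UV epse] g Ug; apply: le_lt_trans epse.
exact: volbar_sliceC_le (oV i).1 (UV _ U1) (UV _ Ug) (appV i).
Qed.
End sofic_volumes.

(** * Comparison of the two entropies at fixed scales, then in the limit *)

Section comparison.
Context {R : realType} {G : topGroupType}.
Context {mG : {measure set (borel G) -> \bar R}}.
Hypotheses (lcG : locally_compact [set: G]) (scG : @second_countable G).
Hypothesis hG : hausdorff_space G.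
Variable Sigma : sofic_approximation mG.
Context {X : ptopologicalType} (cX : compact [set: X]).
Context (mu : probability (borel X) R) (act : G -> X -> X).
Hypothesis act_pmp : continuous_pmp_action mu act.
Variable rho : X -> X -> R.
Hypotheses (prho : is_pseudometric rho) (rho_le1 : forall x y, rho x y <= 1).
Hypothesis crho : continuous (fun xy : X * X => rho xy.1 xy.2).
Variable L : forall i, G * Sigma i -> Sigma i.
(** Measurability is asked section by section so that both the default completion and every Borel
    completion qualify. *)
Hypothesis mL : forall i g, measurable_fun setT
  (fun p : borel (Sigma i) => L (g, p) : borel (Sigma i)).
Hypothesis LE : forall i g p, lgs_dom (g, p) -> @L i (g, p) = lgs_act g p.

Local Notation maps i := {mfun borel (Sigma i) >-> borel X}.

Lemma rho01 x y : 0 <= rho x y <= 1.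
Proof. by rewrite rho_le1 andbT; exact: pseudometric_ge0. Qed.

Lemma log_sep_rate_le i e e' (E E' : set (maps i))
    (d d' : maps i -> maps i -> R) :
  E `<=` E' -> (forall x y, e < d x y -> e' < d' x y) ->
  (log_sep_rate e E d <= log_sep_rate e' E' d')%E.
Proof.
move=> EE' dd'; apply: lee_wpmul2l.
  by rewrite lee_fin invr_ge0 fine_ge0.
by rewrite lee_lne ?in_itv/= ?Sep_ge0 ?leey//; exact: le_Sep.
Qed.

Let mrho i (phi psi : maps i) :
  measurable_fun setT (fun p => rho (phi p) (psi p)).
Proof. exact: (measurable_pseudometric cX prho crho). Qed.

Lemma rho1_le_rho2 i (phi psi : maps i) : rho1 rho phi psi <= rho2 rho phi psi.
Proof. by apply: Rintegral_le_sqrt => [|p]; [exact: mrho|exact: rho01]. Qed.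

Lemma rho2_sqr_le_rho1 i (phi psi : maps i) :
  rho2 rho phi psi ^+ 2 <= rho1 rho phi psi.
Proof.
rewrite sqr_sqrtr; last by apply: Rintegral_ge0 => p _; exact: sqr_ge0.
by apply: Rintegral_sqr_le => [|p]; [exact: mrho|exact: rho01].
Qed.

(** Singh's integrand before squaring; on the slice it coincides with the local integrand, which
    links the two errors. *)
Let err i (phi : maps i) g (p : borel (Sigma i)) : R :=
  rho (phi (L (g, p))) (act g (phi p)).

Let merr i (phi : maps i) g : measurable_fun setT (err phi g).
Proof.
have cact : continuous (act g).
  by apply: continuous_partial; exact: action_continuous act_pmp.
have mphi : measurable_fun setT phi by exact: measurable_funPT.
apply: (measurable_pseudometric cX prho crho).
  exact: measurableT_comp mphi (mL g).
exact: borel_measurable_comp mphi cact.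
Qed.

Let local_errorE i (phi : maps i) g : local_error act rho phi g =
  fine (volbar Sigma i (~` slice (Sigma i) g)) +
  \int[volbar Sigma i]_(p in slice (Sigma i) g) err phi g p.
Proof.
congr (_ + _); apply: eq_Rintegral => p /set_mem Sp.
by rewrite /err LE.
Qed.

Lemma local_error_le i (phi : maps i) g : local_error act rho phi g <=
  fine (volbar Sigma i (~` slice (Sigma i) g)) + singh_error act rho L phi g.
Proof.
rewrite local_errorE lerD2l.
have /andP[h _] := Rintegral_split_le (volbar Sigma i) (merr phi g)
  (fun p => rho01 _ _) (@measurable_slice G (Sigma i) g).
apply: le_trans h _.
by apply: Rintegral_le_sqrt => [|p]; [exact: merr|exact: rho01].
Qed.

Lemma singh_error_sqr_le i (phi : maps i) g :
  singh_error act rho L phi g ^+ 2 <= local_error act rho phi g.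
Proof.
rewrite local_errorE sqr_sqrtr; last first.
  by apply: Rintegral_ge0 => p _; exact: sqr_ge0.
have /andP[_ h] := Rintegral_split_le (volbar Sigma i) (merr phi g)
  (fun p => rho01 _ _) (@measurable_slice G (Sigma i) g).
rewrite addrC; apply: le_trans h.
by apply: Rintegral_sqr_le => [|p]; [exact: merr|exact: rho01].
Qed.

Lemma local_le_singh e :
  (local_entropy_at Sigma act mu rho e <= singh_entropy_at act mu rho L e)%E.
Proof.
apply: le_ereal_inf_tmp => _ [F finF <-].
apply: le_ereal_inf_tmp => _ [U nU <-].
apply: le_ereal_inf_tmp => _ [delta delta0 <-].
apply: le_trans (ereal_inf_lbound _) _.
  by exists (basic_nbhs mu F delta); [exact: nbhs_basic_nbhs|].
apply: le_trans (ereal_inf_lbound _) _; first by exists U.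
apply: le_trans (ereal_inf_lbound _) _.
  (* The tolerance is squared because E^S^2 <= E^B, so E^B < delta^2 forces E^S < delta. *)
  by exists (delta ^+ 2); [exact: exprn_gt0|].
apply: le_limn_esup; apply: nearW => i; apply: log_sep_rate_le.
  move=> phi [small near_mu]; split=> // g Ug.
  have := le_lt_trans (singh_error_sqr_le phi g) (small g Ug).
  by rewrite ltr_pXn2r// nnegrE; [exact: sqrtr_ge0|exact: ltW].
by move=> phi psi h; apply: lt_le_trans h (rho1_le_rho2 _ _).
Qed.

Lemma singh_le_local e : 0 < e ->
  (singh_entropy_at act mu rho L e <=
   local_entropy_at Sigma act mu rho (e ^+ 2))%E.
Proof.
move=> e0; apply: le_ereal_inf_tmp => _ [W nW <-].
apply: le_ereal_inf_tmp => _ [U nU <-].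
apply: le_ereal_inf_tmp => _ [delta delta0 <-].
have [F [eta [finF eta0 FW]]] := nbhs_weak_starP nW.
apply: le_trans (ereal_inf_lbound _) _; first by exists F.
apply: le_trans (ereal_inf_lbound _) _; first by exists U.
have delta2 : 0 < delta / 2 by rewrite divr_gt0.
apply: le_trans (ereal_inf_lbound _) _.
  (* Half of [delta] absorbs the volume off the slice, for large i only, and the other half bounds
     E^S; [eta] controls the pushforward. *)
  by exists (Num.min (delta / 2) eta); [rewrite /= lt_min delta2|].
apply: le_limn_esup.
have := volbar_sliceC_near lcG scG hG Sigma nU delta2.
apply: filterS => i vol_small; apply: log_sep_rate_le.
  move=> phi [small near_mu]; split=> [g Ug|].
    apply: le_lt_trans (local_error_le phi g) _.
    rewrite (splitr delta); apply: ltrD; first exact: vol_small.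
    by have := small g Ug; rewrite lt_min => /andP[].
  by apply: FW => f Ff; have := near_mu f Ff; rewrite lt_min => /andP[].
(* Here the scale changes: e < rho2 gives e^2 < rho2^2 <= rho1. *)
move=> phi psi h; apply: lt_le_trans (rho2_sqr_le_rho1 _ _).
by rewrite ltr_pXn2r// nnegrE; [exact: ltW|exact: sqrtr_ge0].
Qed.

Lemma local_entropy_at_anti e e' : e <= e' ->
  (local_entropy_at Sigma act mu rho e' <=
   local_entropy_at Sigma act mu rho e)%E.
Proof.
move=> ee'; apply: le_ereal_inf_tmp => _ [W nW <-].
apply: le_ereal_inf_tmp => _ [U nU <-].
apply: le_ereal_inf_tmp => _ [delta delta0 <-].
apply: le_trans (ereal_inf_lbound _) _; first by exists W.
apply: le_trans (ereal_inf_lbound _) _; first by exists U.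
apply: le_trans (ereal_inf_lbound _) _; first by exists delta.
apply: le_limn_esup; apply: nearW => i; apply: log_sep_rate_le => // phi psi.
exact: le_lt_trans.
Qed.

Lemma local_entropy_eq_singh :
  local_entropy Sigma act mu rho = singh_entropy act mu rho L.
Proof.
(* By monotonicity in the scale the right limit at 0 is a supremum, taken over ]0,1[ to match the
   range of scales in Singh's definition. *)
have lim_sup : local_entropy Sigma act mu rho =
    ereal_sup (local_entropy_at Sigma act mu rho @` `]0, 1[).
  have b01 : (BRight 0 < BLeft (1 : R))%O by rewrite bnd_simp ltr01.
  have anti : {in Interval (BRight 0) (BLeft (1 : R)) &,
      nonincreasing_fun (local_entropy_at Sigma act mu rho)}.
    by move=> e e' _ _; exact: local_entropy_at_anti.
  have cv := @nonincreasing_at_right_cvge R _ 0 _ b01 anti.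
  exact: (cvg_lim (@ereal_hausdorff R) cv).
rewrite lim_sup; apply/eqP; rewrite eq_le; apply/andP; split.
  apply: ge_ereal_sup => _ [e /= e01 <-]; apply: le_trans (local_le_singh e) _.
  by apply: ereal_sup_ubound; exists e => //; move: e01; rewrite in_itv.
apply: ge_ereal_sup => _ [e /= /andP[e0 e1] <-].
apply: le_trans (singh_le_local e0) _; apply: ereal_sup_ubound.
(* Squaring preserves ]0,1[, so the smaller scale is again admissible in the supremum. *)
by exists (e ^+ 2) => //=; rewrite in_itv/= exprn_gt0// exprn_ilt1// ltW.
Qed.
End comparison.

Theorem theoremA8 (R : realType) (G : topGroupType)
    (G_locally_compact : locally_compact [set: G])
    (G_second_countable : @second_countable G)
    (G_hausdorff : hausdorff_space G)
    (mG : {measure set (borel G) -> \bar R}) (mG_haar : right_haar_measure mG)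
    (G_sofic : sofic mG) (Sigma : sofic_approximation mG) :
  let completed i := completion (M := Sigma i) in
  forall (X : ptopologicalType) (X_compact : compact [set: X])
    (X_metrizable : metrizable R X)
    (mu : probability (borel X) R) (act : G -> X -> X)
    (act_pmp : continuous_pmp_action mu act)
    (rho : X -> X -> R) (rho_pseudometric : is_pseudometric rho)
    (rho_le1 : forall x y, rho x y <= 1)
    (rho_continuous : continuous (fun xy : X * X => rho xy.1 xy.2))
    (rho_generating : generating act rho),
  local_entropy Sigma act mu rho = singh_entropy act mu rho completed /\
  (forall L : forall i, G * Sigma i -> Sigma i,
    (forall i, borel_completion (L i)) ->
    local_entropy Sigma act mu rho = singh_entropy act mu rho L).
Proof.
move=> completed X cX _ mu act act_pmp rho prho rho_le1 crho _; split.
  apply: local_entropy_eq_singh => // [i g|i g p d].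
    exact: measurable_completion.
  by rewrite /completed /completion; destruct (pselect _).
move=> L bL; apply: local_entropy_eq_singh => // [i g|i g p].
  exact: measurable_borel_completion.
exact: (bL i).2.
Qed.
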